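(* There exists an absolute constant $c>0$ such that the following holds. For every field $\mathbb{K}$ of characteristic $0$, every positive integer $n$, and all $n$-tuples $\mathbf{a}=(a_1,\ldots,a_n)\in\mathbb{K}^n$ and $\mathbf{b}=(b_1,\ldots,b_n)\in\mathbb{K}^n$ such that $a_1,\ldots,a_n$ are pairwise distinct and $b_1,\ldots,b_n$ are pairwise distinct, we have $|\mathcal{S}(\mathbf{a},\mathbf{b})|\geq c n^3$.
   Context: For $n$-tuples $\mathbf{a}=(a_1,\ldots,a_n)$ and $\mathbf{b}=(b_1,\ldots,b_n)$ of elements of a field $\mathbb{K}$ and a permutation $\pi$ in the symmetric group $\mathfrak{S}_n$ on $\{1,\ldots,n\}$, define $S(\mathbf{a},\mathbf{b};\pi):=\sum_{i=1}^n a_i b_{\pi(i)}\in\mathbb{K}$, and define the set $\mathcal{S}(\mathbf{a},\mathbf{b}):=\{S(\mathbf{a},\mathbf{b};\pi):\pi\in\mathfrak{S}_n\}$. The constant $c$ does not depend on $\mathbb{K}$, $n$, $\mathbf{a}$, or $\mathbf{b}$. *)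

(* Defs.v *)
From HB Require Import structures.
From mathcomp Require Import all_boot all_order all_algebra all_fingroup.
From mathcomp Require Import finmap.
From mathcomp Require Import reals.

Set Implicit Arguments.
Unset Strict Implicit.
Unset Printing Implicit Defensive.

Import GRing.Theory.
Local Open Scope ring_scope.

Definition perm_sum (K : fieldType) (n : nat) (a b : n.-tuple K) (s : 'S_n) : K :=
  \sum_(i < n) tnth a i * tnth b (s i).

Definition perm_sums (K : fieldType) (n : nat) (a b : n.-tuple K) : {fset K} :=
  [fset perm_sum a b s | s : 'S_n]%fset.

(* Main.v *)
(** Build the permutation greedily, keeping the set [T] of sums obtained from
    the indices used so far.  Using two new indices on each side, matched in
    both possible ways, replaces [T] by a translate of [T] united with [T + d],
    where [d = (x - x') (y - y')]; the gain is [|(T + d) \ T|], a subadditive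
    function of [d].  If [m] indices are left on each side, then some set
    [v A + w A] or [v B + w B] has [m^2] elements, where [v] is a difference of
    elements of the other side and [w] a difference or a sum of two, so its
    translates are sums of at most three [d]'s.  By averaging over a suitable
    iterated sumset of such a translate (Olson's argument), some [d] gains at
    least a constant times [min (|T|, m^2)].  After [n / 4] steps this adds up
    to order [n^3]. *)
Require Import Defs.
From HB Require Import structures.
From mathcomp Require Import all_boot all_order all_algebra all_fingroup.
From mathcomp Require Import finmap.
From mathcomp Require Import reals.
From mathcomp Require Import zify ring.

Set Implicit Arguments.
Unset Strict Implicit.
Unset Printing Implicit Defensive.

Import Order.TTheory GRing.Theory Num.Theory.
Local Open Scope ring_scope.

(** * Translates and sumsets in an abelian group *)

Section AdditiveCombinatorics.
Variable V : zmodType.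
Implicit Types (A B E T X : {fset V}) (x y e d : V).

Definition torsion_free := forall x k, x *+ k.+1 = 0 -> x = 0.

Definition shift x A : {fset V} := [fset (x + t)%R | t in A]%fset.

Definition sumset A B : {fset V} := [fset (x + y)%R | x in A, y in B]%fset.

Fixpoint multisum k E : {fset V} :=
  if k is k'.+1 then sumset E (multisum k' E) else [fset 0%R]%fset.

(** The gain in passing from [T] to its union with [shift x T]; as translates keep cardinality, it
    is also [#|T|] minus the size of their intersection. *)
Definition boundary T x := #|` (shift x T `\` T)%fset|.

Lemma mem_shift x A y : (y \in shift x A) = (y - x \in A).
Proof.
apply/imfsetP/idP => [[t /= tA ->]|yA]; first by rewrite addrC addKr.
by exists (y - x) => //; rewrite addrC subrK.
Qed.

Lemma card_shift x A : #|` shift x A| = #|` A|.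
Proof. by rewrite /shift card_imfset //; exact: addrI. Qed.

Lemma shift0 A : shift 0 A = A.
Proof. by apply/fsetP => y; rewrite mem_shift subr0. Qed.

Lemma sumsetP A B z :
  reflect (exists x y, [/\ x \in A, y \in B & z = x + y]) (z \in sumset A B).
Proof.
apply: (iffP (imfset2P _ _ _ _ _)) => /=.
  by move=> [x xA [y yB ->]]; exists x, y.
by move=> [x [y [xA yB ->]]]; exists x => //; exists y.
Qed.

Lemma mem_sumset A B x y : x \in A -> y \in B -> x + y \in sumset A B.
Proof. by move=> xA yB; apply/sumsetP; exists x, y. Qed.

Section TorsionFree.
Hypothesis tfV : torsion_free.

(** Otherwise [d + A] equals [A] by cardinality, and comparing the sums of their elements gives
    [#|A| d = 0]. *)
Lemma exists_shift_out A d :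
  A != fset0 -> d != 0 -> exists2 x, x \in A & d + x \notin A.
Proof.
move=> A0 d0; have [/fsubsetP AA|] := boolP (shift d A `<=` A)%fset; last first.
  move=> /fsubsetPn[y]; rewrite mem_shift => yA yNA.
  by exists (y - d) => //; rewrite addrC subrK.
have /eqP AE : shift d A == A.
  by rewrite eqEfcard card_shift leqnn andbT; apply/fsubsetP.
have : \sum_(y <- shift d A) y = \sum_(y <- A) y by rewrite AE.
rewrite big_imfset /=; last by move=> x y _ _ /addrI.
rewrite big_split /= -[RHS]add0r => /addIr.
rewrite big_const_seq count_predT iter_addr_0.
have : (0 < #|` A|)%N by rewrite cardfs_gt0.
by case: #|` A| => // k _ /tfV d0'; rewrite d0' eqxx in d0.
Qed.

(* Induction on [B] through the Dyson e-transform: a translate of [B] that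
   meets [A] without being contained in it is replaced by its intersection with
   [A], while [A] absorbs the rest. *)
Lemma card_sumset A B : A != fset0 -> B != fset0 ->
  (#|` A| + #|` B| <= #|` sumset A B|.+1)%N.
Proof.
have [m] := ubnP #|` B|; elim: m A B => // m IH A B Bm A0 B0.
have [b bB] := fset0Pn _ B0.
have [Bb|] := boolP (B `<=` [fset b])%fset.
  have cB : (#|` B| <= 1)%N.
    by rewrite (leq_trans (fsubset_leq_card Bb)) // cardfs1.
  suff sAB : (#|` A| <= #|` sumset A B|)%N by lia.
  rewrite -(card_shift b); apply: fsubset_leq_card; apply/fsubsetP => y.
  by rewrite mem_shift => yA; rewrite -(subrK b y) mem_sumset.
move=> /fsubsetPn[b' b'B]; rewrite inE => b'b.
have d0 : b' - b != 0 by rewrite subr_eq0.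
have [a aA aNA] := exists_shift_out A0 d0.
(* [S] contains [a], the image of [b], and [b' - b + a], the image of [b']; the second lies outside
   [A], so the intersection of [A] and [S] is smaller than [B]. *)
pose S := shift (a - b) B.
have aS : a \in S by rewrite mem_shift opprB addrC subrK.
have a'S : b' - b + a \in S.
  by rewrite mem_shift (_ : _ - (a - b) = b') // opprB addrA (addrAC _ a) subrK addrK.
have cS : (#|` (A `&` S)%fset| < #|` B|)%N.
  rewrite -(card_shift (a - b) B); apply: fproper_ltn_card.
  rewrite fproperE fsubsetIr /=; apply/fsubsetPn; exists (b' - b + a) => //.
  by rewrite inE (negPf aNA).
have := IH (A `|` S)%fset (A `&` S)%fset.
have -> : (#|` (A `|` S)%fset| + #|` (A `&` S)%fset| = #|` A| + #|` B|)%N.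
  by rewrite cardfsUI card_shift.
move=> /(_ (leq_trans cS Bm)) -/(_ _ _)/leq_trans; apply.
- by apply/fset0Pn; exists a; rewrite inE aA.
- by apply/fset0Pn; exists a; rewrite inE aA.
rewrite ltnS -(card_shift (a - b) (sumset A B)).
apply: fsubset_leq_card; apply/fsubsetP => z /sumsetP[x [y [+ + ->]]].
rewrite !inE !mem_shift => xAS /andP[yA yS].
case/orP: xAS => [xA|xS]; first by rewrite -addrA mem_sumset.
by rewrite (addrC x) -addrA mem_sumset.
Qed.

Lemma multisum_neq0 k E : E != fset0 -> multisum k E != fset0.
Proof.
move=> /fset0Pn[e eE]; elim: k => [|k /fset0Pn[x xE]].
  by apply/fset0Pn; exists 0; rewrite inE.
by apply/fset0Pn; exists (e + x); apply: mem_sumset.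
Qed.

Lemma card_multisum k E : E != fset0 ->
  (k * #|` E|.-1 < #|` multisum k E|)%N.
Proof.
move=> E0; elim: k => [|k IH]; first by rewrite cardfs1.
have := card_sumset E0 (multisum_neq0 k E0); move: IH.
have : (0 < #|` E|)%N by rewrite cardfs_gt0.
rewrite mulSn /=; set p := (k * _)%N; lia.
Qed.

End TorsionFree.

Lemma boundary0 T : boundary T 0 = 0%N.
Proof. by rewrite /boundary shift0 fsetDv cardfs0. Qed.

(** A point of [x + y + T] outside [T] either lies in [y + T], or lies in the translate by [y] of
    [(x + T) \ T]. *)
Lemma boundaryD T x y : (boundary T (x + y) <= boundary T x + boundary T y)%N.
Proof.
rewrite /boundary -(card_shift y (shift x T `\` T)%fset).
apply: leq_trans (leq_card_fsetU _ _).1.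
apply: fsubset_leq_card; apply/fsubsetP => z.
rewrite !(inE, mem_shift) opprD addrA (addrAC z) => /andP[-> ->].
by rewrite andbT /=; case: (_ \in _).
Qed.

Lemma sum_card_shiftI T X :
  (\sum_(x <- X) #|` (shift x T `&` T)%fset| <= #|` T| * #|` T|)%N.
Proof.
have card_sum (A : {fset V}) (P : pred V) :
    (\sum_(t <- A) P t = #|` [fset t in A | P t]|%fset)%N.
  rewrite card_fset_sum1 -big_fset_condE [RHS]big_mkcond.
  by apply: eq_bigr => t _; case: (P t).
have -> : (\sum_(x <- X) #|` (shift x T `&` T)%fset| =
           \sum_(x <- X) \sum_(t <- T) (t - x \in T)%R)%N.
  apply: eq_bigr => x _; rewrite card_sum; congr #|` _|.
  by apply/fsetP => t; rewrite !inE mem_shift andbC.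
have -> : (#|` T| * #|` T| = \sum_(t <- T) #|` T|)%N.
  by rewrite big_const_seq count_predT iter_addn_0.
rewrite exchange_big /=; apply: leq_sum => t _.
have card_sub_t (Y : {fset V}) : #|` [fset (t - x)%R | x in Y]%fset| = #|` Y|.
  by rewrite card_imfset //; exact: subrI.
rewrite card_sum -card_sub_t; apply: fsubset_leq_card; apply/fsubsetP => y /imfsetP[x /=].
by rewrite !inE => /andP[_ xT] ->.
Qed.

Lemma boundary_multisum T E L k : (forall e, e \in E -> (boundary T e <= L)%N) ->
  forall x, x \in multisum k E -> (boundary T x <= k * L)%N.
Proof.
move=> EL; elim: k => [|k IH] x; first by rewrite inE => /eqP->; rewrite boundary0.
case/sumsetP => e [y [eE yE ->]]; rewrite mulSn.
by rewrite (leq_trans (boundaryD _ _ _)) // leq_add ?EL ?IH.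
Qed.

(* A set [X] with [2 |T| <= |X|] cannot consist of translations with boundary
   less than [|T| / 2], since a pair of points of [T] determines the translation
   from one to the other.  This is applied to the [k]-fold sumset of [E] with
   the smallest [k] making it large enough. *)
Lemma boundary_lower T E L : torsion_free -> T != fset0 -> (1 < #|` E|)%N ->
  (forall e, e \in E -> (boundary T e <= L)%N) ->
  (#|` T| <= 2 * L)%N || (#|` E| <= 8 * L)%N.
Proof.
move=> tfV T0 E1 EL; rewrite -cardfs_gt0 in T0.
have E0 : E != fset0 by rewrite -cardfs_gt0; lia.
have exk : exists k, (2 * #|` T| <= k * #|` E|.-1 + 1)%N.
  by exists (2 * #|` T|)%N; nia.
have [k kT kmin] := ex_minnP exk.
pose X := multisum k E.
have XT : (2 * #|` T| <= #|` X|)%N.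
  by have := card_multisum tfV k E0; rewrite -/X; lia.
have lowX : (#|` X| * (#|` T| - k * L) <= #|` T| * #|` T|)%N.
  apply: leq_trans (sum_card_shiftI T X).
  have -> : (#|` X| * (#|` T| - k * L) = \sum_(x <- X) (#|` T| - k * L))%N.
    by rewrite big_const_seq count_predT iter_addn_0 mulnC.
  rewrite big_seq [leqRHS]big_seq; apply: leq_sum => x xX.
  have := boundary_multisum EL xX.
  rewrite /boundary -(card_shift x T) -(cardfsID T (shift x T)); lia.
(* If [k * L] were below [#|T| / 2], each of the at least [2 #|T|] translates would meet [T] in more
   than half of it, exceeding [#|T|^2] in total. *)
have TkL : (#|` T| <= 2 * (k * L))%N.
  have [//|h] := leqP; have : (2 * #|` T| * (#|` T| - k * L) <= #|` T| * #|` T|)%N.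
    by apply: leq_trans lowX; rewrite leq_mul2r XT orbT.
  nia.
(* [k = 0] is impossible and [k = 1] gives the first alternative. For larger [k], minimality bounds
   [(k - 1) (#|E| - 1)] by [2 #|T| <= 4 k L], and [k <= 2 (k - 1)]. *)
case: k kT kmin @X XT lowX TkL => [|[|k]] kT kmin X XT lowX TkL; first by lia.
  by rewrite mul1n in TkL; rewrite TkL.
have := contraNN (kmin k.+1); rewrite ltnn => /(_ isT); rewrite -ltnNge => kE.
apply/orP; right.
have : (k.+1 * #|` E|.-1 < k.+1 * (8 * L))%N by nia.
by rewrite ltn_mul2l; lia.
Qed.

End AdditiveCombinatorics.

(** * Difference sets, their quotients and dilates in a field *)

Section Field.
Variable K : fieldType.
Implicit Types (A B T : {fset K}) (x y z u v d : K).

Definition differences A : {fset K} := [fset (x - y)%R | x in A, y in A]%fset.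

Definition quotients A : {fset K} :=
  [fset (x / y)%R | x in differences A, y in (differences A `\ 0%R)%fset]%fset.

Definition rectangles A B : {fset K} :=
  [fset (x * y)%R | x in differences A, y in differences B]%fset.

Lemma pchar0_torsion_free : [pchar K] =i pred0 -> torsion_free K.
Proof.
move=> char0 x k /eqP; rewrite -mulr_natr mulf_eq0 => /orP[/eqP//|].
by rewrite (pcharf0P K).1.
Qed.

Lemma mem_differences A x y : x \in A -> y \in A -> x - y \in differences A.
Proof. exact: in_imfset2. Qed.

Lemma differencesP A z :
  reflect (exists x y, [/\ x \in A, y \in A & z = x - y]) (z \in differences A).
Proof.
apply: (iffP (imfset2P _ _ _ _ _)) => /=.
  by move=> [x xA [y yA ->]]; exists x, y.
by move=> [x [y [xA yA ->]]]; exists x => //; exists y.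
Qed.

Lemma mem_rectangles A B x y :
  x \in differences A -> y \in differences B -> x * y \in rectangles A B.
Proof. exact: in_imfset2. Qed.

Lemma rectanglesC A B : rectangles A B = rectangles B A.
Proof.
suff sub A' B' : (rectangles A' B' `<=` rectangles B' A')%fset.
  by apply/eqP; rewrite eqEfsubset !sub.
apply/fsubsetP => z /imfset2P[x /= xA [y /= yB ->]].
by rewrite mulrC mem_rectangles.
Qed.

Lemma mem_quotients A x y : x \in differences A -> y \in differences A ->
  y != 0 -> x / y \in quotients A.
Proof. by move=> xA yA y0; apply: in_imfset2 => //=; rewrite !inE y0. Qed.

Lemma quotientsP A z : reflect (exists x y,
   [/\ x \in differences A, y \in differences A, y != 0 & z = x / y])
  (z \in quotients A).
Proof.
apply: (iffP (imfset2P _ _ _ _ _)) => /=.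
  by move=> [x xA [y]]; rewrite !inE => /andP[y0 yA] ->; exists x, y.
by move=> [x [y [xA yA y0 ->]]]; exists x => //; exists y; rewrite // !inE y0.
Qed.

Lemma quotients_neq0 A : (1 < #|` A|)%N -> quotients A != fset0.
Proof.
move=> A1; have /fset0Pn[x xA] : A != fset0 by rewrite -cardfs_gt0; lia.
have /fset0Pn[y] : (A `\ x)%fset != fset0.
  by rewrite -cardfs_gt0; move: A1; rewrite (cardfsD1 x) xA; lia.
rewrite !inE => /andP[yx yA]; apply/fset0Pn; exists ((x - x) / (y - x)).
by rewrite mem_quotients ?mem_differences ?subr_eq0.
Qed.

(** A coincidence [v x + u y = v x' + u y'] with [y] different from [y'] would write [u / v] as
    [(x - x') / (y' - y)]. *)
Lemma card_dilates A u v : v != 0 -> u / v \notin quotients A ->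
  #|` [fset (v * x + u * y)%R | x in A, y in A]%fset| = (#|` A| * #|` A|)%N.
Proof.
move=> v0 uvA.
have inj2 x y x' y' : x \in A -> y \in A -> x' \in A -> y' \in A ->
    v * x + u * y = v * x' + u * y' -> x = x' /\ y = y'.
  move=> xA yA x'A y'A e.
  have [yy'|ny] := eqVneq y y'.
    by move: e; rewrite yy' => /addIr /(mulfI v0) ->.
  case/negP: uvA; have -> : u / v = (x - x') / (y' - y).
    apply/eqP; rewrite eqr_div // ?subr_eq0 1?eq_sym // -subr_eq0.
    have -> : (x - x') * v - u * (y' - y) =
      (v * x + u * y) - (v * x' + u * y') by ring.
    by rewrite e subrr.
  by rewrite mem_quotients ?mem_differences // subr_eq0 eq_sym.
rewrite (perm_size (enum_imfset2 _ _)).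
  by rewrite size_allpairs.
move=> [x y] [x' y']; rewrite !inE /= => /andP[xA yA] /andP[x'A y'A] e.
by have [-> ->] := inj2 _ _ _ _ xA yA x'A y'A e.
Qed.

(* Being finite, [quotients A] contains some [q] with [q + 1] not in it.  If [q]
   is in [quotients B], dilate [A] by the numerator and denominator of [q + 1];
   otherwise dilate [B] by those of [q]. *)
Lemma exists_large_dilates A B : [pchar K] =i pred0 ->
  (1 < #|` A|)%N -> (1 < #|` B|)%N ->
  (exists u v, [/\ u \in differences B, v \in differences B &
     exists2 w, w = u \/ w = u + v &
     #|` [fset (v * x + w * y)%R | x in A, y in A]%fset| = (#|` A| * #|` A|)%N])
  \/
  (exists u v, [/\ u \in differences A, v \in differences A &
     exists2 w, w = u \/ w = u + v &
     #|` [fset (v * x + w * y)%R | x in B, y in B]%fset| = (#|` B| * #|` B|)%N]).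
Proof.
move=> char0 A1 B1.
have [q qA q1A] := exists_shift_out (pchar0_torsion_free char0)
  (quotients_neq0 A1) (oner_neq0 K).
have [/quotientsP[u [v [uB vB v0 qE]]]|qB] := boolP (q \in quotients B).
  left; exists u, v; split=> //; exists (u + v); first by right.
  by apply: card_dilates; rewrite // mulrDl divff // -qE addrC.
have /quotientsP[u [v [uA vA v0 qE]]] := qA.
by right; exists u, v; split=> //; exists u; [left | apply: card_dilates; rewrite -?qE].
Qed.


(** Translated by [- (v a + w a)], the dilate sum consists of sums of at most three rectangles, with
    boundary at most [3 L]; [boundary_lower] then yields 6 and 24. *)
Lemma boundary_dilates T A B L u v w : [pchar K] =i pred0 -> T != fset0 ->
  (1 < #|` A|)%N ->
  (forall d, d \in rectangles A B -> (boundary T d <= L)%N) ->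
  u \in differences B -> v \in differences B -> w = u \/ w = u + v ->
  #|` [fset (v * x + w * y)%R | x in A, y in A]%fset| = (#|` A| * #|` A|)%N ->
  (#|` T| <= 6 * L)%N || (#|` A| * #|` A| <= 24 * L)%N.
Proof.
move=> char0 T0 A1 TL uB vB wE cE.
have /fset0Pn[a aA] : A != fset0 by rewrite -cardfs_gt0; lia.
set D := [fset (v * x + w * y)%R | x in A, y in A]%fset in cE *.
rewrite (_ : 6 = 2 * 3)%N // (_ : 24 = 8 * 3)%N // -!mulnA -cE.
rewrite -(card_shift (- (v * a + w * a)) D).
apply: boundary_lower => //; first exact: pchar0_torsion_free.
  by rewrite card_shift cE; nia.
move=> e; rewrite mem_shift opprK => /imfset2P[x /= xA [y yA]].
move/(canRL (addrK _)) ->.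
have Tv : (boundary T ((x - a) * v)%R <= L)%N.
  by apply/TL/mem_rectangles; rewrite ?mem_differences.
have Tu : (boundary T ((y - a) * u)%R <= L)%N.
  by apply/TL/mem_rectangles; rewrite ?mem_differences.
have Tv' : (boundary T ((y - a) * v)%R <= L)%N.
  by apply/TL/mem_rectangles; rewrite ?mem_differences.
case: wE => ->.
  have -> : v * x + u * y - (v * a + u * a) = (x - a) * v + (y - a) * u by ring.
  apply: leq_trans (boundaryD _ _ _) _; apply: leq_trans (leq_add Tv Tu) _; lia.
have -> : v * x + (u + v) * y - (v * a + (u + v) * a) =
  (x - a) * v + ((y - a) * u + (y - a) * v) by ring.
rewrite (_ : 3 * L = L + (L + L))%N; last by lia.
apply: leq_trans (boundaryD _ _ _) (leq_add Tv _).
exact: leq_trans (boundaryD _ _ _) (leq_add Tu Tv').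
Qed.

Lemma exists_rectangle T A B m : [pchar K] =i pred0 -> T != fset0 ->
  (1 < m)%N -> #|` A| = m -> #|` B| = m ->
  exists2 d, d \in rectangles A B &
    (#|` T| <= 6 * boundary T d)%N || (m * m <= 24 * boundary T d)%N.
Proof.
move=> char0 T0 m1 Am Bm.
pose P d := (#|` T| <= 6 * boundary T d)%N || (m * m <= 24 * boundary T d)%N.
have [/hasP//|/hasPn noP] := boolP (has P (rectangles A B)).
have T1 : (0 < #|` T|)%N by rewrite cardfs_gt0.
(* The largest [L] with both [6 L < #|T|] and [24 L < m^2]; it bounds every boundary if no rectangle
   works. *)
pose L := minn (#|` T|.-1 %/ 6) ((m * m).-1 %/ 24).
have TL d : d \in rectangles A B -> (boundary T d <= L)%N.
  by move=> /noP; rewrite /P /L; set q := (m * m)%N; lia.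
have : (#|` T| <= 6 * L)%N || (m * m <= 24 * L)%N.
  have A1 : (1 < #|` A|)%N by rewrite Am.
  have B1 : (1 < #|` B|)%N by rewrite Bm.
  have [] := exists_large_dilates char0 A1 B1 => - [u [v [uD vD [w wE]]]].
    by move/(boundary_dilates char0 T0 A1 TL uD vD wE); rewrite Am.
  rewrite rectanglesC in TL.
  by move/(boundary_dilates char0 T0 B1 TL uD vD wE); rewrite Bm.
have : (0 < m * m)%N by rewrite muln_gt0; lia.
by rewrite /L; set q := (m * m)%N; lia.
Qed.

End Field.

(** * Partial matchings of lists and their greedy growth *)

Section Dots.
Variable K : fieldType.
Implicit Types (s t u v : seq K).

Definition dot s t : K := \sum_(p <- zip s t) p.1 * p.2.

Definition dots s t : {fset K} := [fset dot s t' | t' in permutations t]%fset.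

Lemma dot_cons x y s t : dot (x :: s) (y :: t) = x * y + dot s t.
Proof. by rewrite /dot /= big_cons. Qed.

Lemma dot_cat s1 s2 t1 t2 : size s1 = size t1 ->
  dot (s1 ++ s2) (t1 ++ t2) = dot s1 t1 + dot s2 t2.
Proof. by move=> h; rewrite /dot zip_cat // big_cat. Qed.

Lemma dotsP s t z :
  reflect (exists2 t', perm_eq t' t & z = dot s t') (z \in dots s t).
Proof.
apply: (iffP (imfsetP _ _ _ _)) => /= -[t']; rewrite ?mem_permutations => tt' ->.
  by exists t'.
by exists t'; rewrite //= mem_permutations.
Qed.

Lemma dots_neq0 s t : dots s t != fset0.
Proof. by apply/fset0Pn; exists (dot s t); apply/dotsP; exists t. Qed.

(** The matchings [x y' + x' y] and [x y + x' y'] differ by [(x - x') (y - y')]. *)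
Lemma card_dots_swap x x' y y' s t :
  (#|` dots s t| + boundary (dots s t) ((x - x') * (y - y'))%R <=
   #|` dots (x :: x' :: s) (y' :: y :: t)|)%N.
Proof.
set T := dots s t; set d := (x - x') * (y - y').
have -> : (#|` T| + boundary T d = #|` (T `|` shift d T)%fset|)%N.
  rewrite /boundary cardfsD cardfsU fsetIC addnBA //.
  exact: fsubset_leq_card (fsubsetIr _ _).
rewrite -(card_shift (x * y' + x' * y)); apply: fsubset_leq_card.
apply/fsubsetP => z; rewrite mem_shift inE mem_shift.
case/orP => /dotsP[t' tt']; rewrite ?subr_eq => zE; apply/dotsP.
  exists (y' :: y :: t'); first by rewrite !perm_cons.
  by rewrite !dot_cons -(subrK (x * y' + x' * y) z) zE; ring.
exists (y :: y' :: t').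
  by rewrite (perm_catCA [:: y] [:: y']) /= !perm_cons.
rewrite !dot_cons -(subrK (x * y' + x' * y) z) -(subrK d (z - _)) zE /d; ring.
Qed.

Lemma perm_eq_rem2 (x y : K) s : x \in s -> y \in s -> x != y ->
  perm_eq s (x :: y :: rem y (rem x s)).
Proof.
move=> xs ys xy; rewrite (perm_trans (perm_to_rem xs)) // perm_cons.
apply: perm_to_rem; move: ys.
by rewrite (perm_mem (perm_to_rem xs)) inE eq_sym (negPf xy).
Qed.

Lemma exists_swap s t u v m : [pchar K] =i pred0 -> uniq s -> uniq t ->
  (1 < m)%N -> size s = m -> size t = m ->
  exists x x' s' y y' t' k,
    [/\ perm_eq s (x :: x' :: s'), perm_eq t (y :: y' :: t'),
       (#|` dots u v| + k <= #|` dots (x :: x' :: u) (y :: y' :: v)|)%N &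
       (#|` dots u v| <= 6 * k)%N || (m * m <= 24 * k)%N].
Proof.
move=> char0 us ut m1 sm tm.
have cS : #|` [fset x in s]%fset| = m by rewrite card_fseq undup_id.
have cT : #|` [fset x in t]%fset| = m by rewrite card_fseq undup_id.
have [d dR] := exists_rectangle char0 (dots_neq0 u v) m1 cS cT.
set k := boundary _ d => km.
(* A zero [d] would gain nothing. Hence [x], [x'] are distinct, as are [y], [y'], and both pairs can
   be removed from the lists. *)
have d0 : d != 0.
  apply: contraTneq km => d0; rewrite /k d0 boundary0 !muln0 !leqn0 muln_eq0.
  by rewrite cardfs_eq0 (negPf (dots_neq0 u v)); lia.
move: dR => /imfset2P[_ /= /differencesP[x [x' [xs x's ->]]]].
move=> [_ /differencesP[y [y' [yt y't ->]]] dE].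
move: d0; rewrite dE mulf_eq0 !subr_eq0 negb_or => /andP[xx' yy'].
rewrite !inE in xs x's yt y't.
exists x, x', (rem x' (rem x s)), y', y, (rem y (rem y' t)), k; split=> //.
- exact: perm_eq_rem2.
- by apply: perm_eq_rem2; rewrite // eq_sym.
- by rewrite /k dE card_dots_swap.
Qed.

(** Up to [i + 1 = 20] the factor [20 ^ 3] suffices. Beyond, either [t] grows by a factor 7/6, at
    least [(21/20)^3], or [k] is at least [(i + 1)^2 / 6], which outweighs the growth of the
    cube. *)
Lemma greedy_growth (i m t k : nat) : (2 * i.+1 <= m)%N -> (0 < t)%N ->
  (i ^ 3 <= 20 ^ 3 * t)%N -> (t <= 6 * k)%N || (m * m <= 24 * k)%N ->
  (i.+1 ^ 3 <= 20 ^ 3 * (t + k))%N.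
Proof.
move=> im t0 it tk; rewrite !expnS expn0 !muln1 in it *.
have [i20|i20] := leqP i.+1 20.
  have : (i.+1 * (i.+1 * i.+1) <= 20 * (20 * 20))%N by rewrite !leq_mul.
  have : (20 * (20 * 20) <= 20 * (20 * 20) * (t + k))%N by rewrite leq_pmulr //; lia.
  lia.
case/orP: tk => [tk|mk].
  have : (6 * (i.+1 * (i.+1 * i.+1)) <= 7 * (i * (i * i)))%N by nia.
  lia.
have : (4 * (i.+1 * i.+1) <= 24 * k)%N by nia.
nia.
Qed.

Lemma greedy_dots s t n : [pchar K] =i pred0 -> uniq s -> uniq t ->
  size s = n -> size t = n -> forall i, (4 * i <= n)%N ->
  exists u s' v t',
    [/\ perm_eq s (u ++ s'), perm_eq t (v ++ t'),
       size u = (2 * i)%N, size v = (2 * i)%N &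
       (i ^ 3 <= 20 ^ 3 * #|` dots u v|)%N].
Proof.
move=> char0 us ut sn tn; elim=> [|i IH] i_n; first by exists [::], s, [::], t.
have [|u [s' [v [t' [ss' tt' ui vi ih]]]]] := IH; first by lia.
have us' : uniq s' by move: us; rewrite (perm_uniq ss') cat_uniq => /and3P[].
have ut' : uniq t' by move: ut; rewrite (perm_uniq tt') cat_uniq => /and3P[].
have ss'n : size s' = (n - 2 * i)%N.
  by rewrite -sn (perm_size ss') size_cat ui addKn.
have st'n : size t' = (n - 2 * i)%N.
  by rewrite -tn (perm_size tt') size_cat vi addKn.
have [|x [x' [s2 [y [y' [t2 [k [ps pt uv km]]]]]]]] :=
  exists_swap u v char0 us' ut' _ ss'n st'n; first by lia.
exists (x :: x' :: u), s2, (y :: y' :: v), t2; split; rewrite /= ?ui ?vi ?mulnS //.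
- rewrite (perm_trans ss') // (perm_trans (perm_cat (perm_refl u) ps)) //.
  by rewrite (perm_catCA _ [:: x; x']).
- rewrite (perm_trans tt') // (perm_trans (perm_cat (perm_refl v) pt)) //.
  by rewrite (perm_catCA _ [:: y; y']).
apply: leq_trans (leq_mul (leqnn _) uv).
apply: greedy_growth km => //; first by lia.
by rewrite cardfs_gt0 dots_neq0.
Qed.

Lemma dot_perm_sums n (a b : n.-tuple K) s t :
  perm_eq s a -> perm_eq t b -> dot s t \in perm_sums a b.
Proof.
move=> /tuple_permP[p ->] /tuple_permP[q ->].
(* [s] and [t] list [a] along [p] and [b] along [q], so position [p i] of [a] meets position [q i]
   of [b]. *)
apply/imfsetP; exists (p^-1 * q)%g => //=.
rewrite /perm_sum (reindex_inj (@perm_inj _ p)) /dot /=.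
rewrite zip_map big_map big_enum /=.
by apply: eq_bigr => i _; rewrite permM permK.
Qed.

(** A fixed matching of the leftovers [s] and [t] merely translates the sums of [u] and [v]. *)
Lemma card_dots_perm_sums n (a b : n.-tuple K) u s v t :
  perm_eq a (u ++ s) -> perm_eq b (v ++ t) -> size u = size v ->
  (#|` dots u v| <= #|` perm_sums a b|)%N.
Proof.
move=> aus bvt uv; rewrite -(card_shift (dot s t)).
apply: fsubset_leq_card; apply/fsubsetP => z; rewrite mem_shift.
move=> /dotsP[v' vv' /(canRL (subrK _)) ->].
rewrite -dot_cat; last by rewrite uv (perm_size vv').
apply: dot_perm_sums; first by rewrite perm_sym.
by rewrite (perm_trans (perm_cat vv' (perm_refl t))) // perm_sym.
Qed.

End Dots.

Theorem theorem1p1 (R : realType) :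
  exists2 c : R, 0 < c &
    forall (K : fieldType) (n : nat) (a b : n.-tuple K),
      [pchar K] =i pred0 -> (0 < n)%N -> uniq a -> uniq b ->
      c * n%:R ^+ 3 <= (#|` perm_sums a b|%fset)%:R.
Proof.
(* The 20 comes from [greedy_dots], the 7 from [n <= 7 * (n %/ 4)] for [n >= 4]; for smaller [n] a
   single sum is enough. *)
exists ((7 * 20)%:R ^- 3); first by rewrite invr_gt0 exprn_gt0 // ltr0n.
move=> K n a b char0 n0 ua ub.
rewrite mulrC ler_pdivrMr ?exprn_gt0 ?ltr0n // -!natrX -natrM ler_nat mulnC.
have [|u [s [v [t [aus bvt us vs h]]]]] :=
  greedy_dots char0 ua ub (size_tuple a) (size_tuple b) (i := n %/ 4).
  by lia.
have N0 : (0 < #|` perm_sums a b|)%N.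
  rewrite cardfs_gt0; apply/fset0Pn; exists (dot a b).
  exact: dot_perm_sums.
have [n4|n4] := ltnP n 4.
  apply: (@leq_trans ((7 * 20) ^ 3)); first by rewrite leq_exp2r //; lia.
  exact: leq_pmulr.
apply: (@leq_trans ((7 * (n %/ 4)) ^ 3)); first by rewrite leq_exp2r //; lia.
rewrite (expnMn 7 (n %/ 4)) (expnMn 7 20) -mulnA.
apply: leq_mul (leqnn _) (leq_trans h (leq_mul (leqnn _) _)).
by apply: card_dots_perm_sums aus bvt _; rewrite us vs.
Qed.
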